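(* Let $A\in\mathbb{R}^{n\times n}$ be a nonsingular matrix and let $\nu=\|A^{-1}\|_2$. Suppose $\nu\in(0,1)$ and define, for $\omega\in\left(0,\frac{2-2\sqrt{\nu}}{1-\nu}\right)$, $$g_\nu(\omega)=2|1-\omega|+\omega^2\nu+\omega\sqrt{4|1-\omega|\nu+\omega^2\nu^2}.$$ Then the optimal iterative parameter, i.e. the (unique) point of the interval $\left(0,\frac{2-2\sqrt{\nu}}{1-\nu}\right)$ at which $g_\nu$ attains its minimum over that interval, is $\omega=1$.
   Context: $\|\cdot\|_2$ denotes the matrix norm induced by the Euclidean norm. Here $\omega$ is the parameter of the SOR-like iteration $x^{(k+1)}=(1-\omega)x^{(k)}+\omega A^{-1}(y^{(k)}+b)$, $y^{(k+1)}=(1-\omega)y^{(k)}+\omega|x^{(k+1)}|$ for solving $Ax-|x|=b$, where $|x|$ is the entrywise absolute value. The function $g_\nu(\omega)$ equals $2\rho(W)$, where $\rho$ is the spectral radius and $W=\begin{bmatrix}|1-\omega| & \omega\nu\\ \omega|1-\omega| & \omega^2\nu+|1-\omega|\end{bmatrix}$ is the matrix bounding the errors of the iteration. *)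

(* Defs.v *)
From mathcomp Require Import all_boot all_order all_algebra.
From mathcomp Require Import classical_sets set_interval reals.

Set Implicit Arguments.
Unset Strict Implicit.
Unset Printing Implicit Defensive.

Import Order.TTheory GRing.Theory Num.Theory.
Local Open Scope classical_set_scope.
Local Open Scope ring_scope.

Definition vnorm2 (R : realType) (n : nat) (x : 'cV[R]_n) : R :=
  Num.sqrt (\sum_(i < n) x i 0 ^+ 2).

(* For n = 0 the set is empty and [sup] returns 0; for n > 0 it is nonempty
   and bounded, so [sup] is its least upper bound. *)
Definition mxnorm2 (R : realType) (m n : nat) (A : 'M[R]_(m, n)) : R :=
  sup [set vnorm2 (A *m x) / vnorm2 x | x in [set x : 'cV[R]_n | x != 0]].

Definition gfun (R : realType) (nu omega : R) : R :=
  2 * `|1 - omega| + omega ^+ 2 * nu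
  + omega * Num.sqrt (4 * `|1 - omega| * nu + omega ^+ 2 * nu ^+ 2).

Definition is_minimizer (R : realType) (f : R -> R) (D : set R) (x : R) : Prop :=
  D x /\ forall y, D y -> f x <= f y.

(* Main.v *)
Require Import Defs.
From mathcomp Require Import all_boot all_order all_algebra.
From mathcomp Require Import classical_sets set_interval reals.
From mathcomp Require Import ring lra.

(** Since [gfun nu 1 = 2 * nu], the claim is that [gfun nu omega > 2 * nu] for
    every positive [omega != 1], together with the fact that [1] lies in the
    interval.  Put [a = `|1 - omega|].

    For [omega > 1], dropping [4 * a * nu] under the square root leaves
    [2 * a + 2 * omega ^+ 2 * nu], which exceeds [2 * nu].

    For [omega < 1] we have [omega = 1 - a], and that bound falls below
    [2 * nu] when [nu] and [omega] are close to [1].  The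
    right one is [(1 + a) * nu] for the square root: its square differs from
    the radicand by [4 * a * nu * (1 - nu)], which is where [nu < 1] enters.
    It yields
    [gfun nu omega >= 2 * a + omega * (omega + 1 + a) * nu
                    = 2 * a + 2 * (1 - a) * nu = 2 * nu + 2 * a * (1 - nu)]. *)

Set Implicit Arguments.
Unset Strict Implicit.
Unset Printing Implicit Defensive.

Import Order.TTheory GRing.Theory Num.Theory.
Local Open Scope classical_set_scope.
Local Open Scope ring_scope.

Lemma gfun1 (R : realType) (nu : R) : 0 <= nu -> gfun nu 1 = 2 * nu.
Proof.
move=> nu0; rewrite /gfun subrr normr0 !mulr0 mul0r !add0r !expr1n !mul1r.
by rewrite sqrtr_sqr ger0_norm // mulr_natl mulr2n.
Qed.

Lemma ler_sqrt_sqr (R : realType) (x y : R) :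
  0 <= x -> x ^+ 2 <= y -> x <= Num.sqrt y.
Proof.
by move=> x0 xy; rewrite -(ger0_norm x0) -sqrtr_sqr ler_wsqrtr.
Qed.

Lemma gfun_gt_over (R : realType) (nu omega : R) :
  0 < nu -> 1 < omega -> 2 * nu < gfun nu omega.
Proof.
move=> nu0 w1; rewrite /gfun ltr0_norm ?subr_lt0 // opprB.
set s := Num.sqrt _.
have s_ge : omega * nu <= s.
  apply: ler_sqrt_sqr; first by nra.
  by rewrite exprMn lerDr !mulr_ge0 //; lra.
have ws_ge : omega * (omega * nu) <= omega * s by rewrite ler_wpM2l //; lra.
have w2_gt : 0 < (omega ^+ 2 - 1) * nu by rewrite mulr_gt0 //; nra.
by nra.
Qed.

Lemma gfun_gt_under (R : realType) (nu omega : R) :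
  0 < nu < 1 -> 0 < omega < 1 -> 2 * nu < gfun nu omega.
Proof.
move=> /andP[nu0 nu1] /andP[w0 w1]; rewrite /gfun gtr0_norm ?subr_gt0 //.
set s := Num.sqrt _.
(* Here [2 - omega] is [1 + a]. *)
have s_ge : (2 - omega) * nu <= s.
  apply: ler_sqrt_sqr; first by nra.
  rewrite -subr_ge0.
  have -> : 4 * (1 - omega) * nu + omega ^+ 2 * nu ^+ 2
            - ((2 - omega) * nu) ^+ 2 = 4 * (1 - omega) * nu * (1 - nu).
    by ring.
  by rewrite !mulr_ge0 //; lra.
have ws_ge : omega * ((2 - omega) * nu) <= omega * s by rewrite ler_wpM2l //; lra.
have gap : 0 < (1 - omega) * (1 - nu) by rewrite mulr_gt0 //; lra.
by nra.
Qed.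

(** With [s = Num.sqrt nu], this amounts to [0 < (1 - s) ^+ 2]. *)
Lemma lt1_bound (R : realType) (nu : R) :
  0 <= nu < 1 -> 1 < (2 - 2 * Num.sqrt nu) / (1 - nu).
Proof.
move=> /andP[nu0 nu1]; rewrite ltr_pdivlMr ?subr_gt0 // mul1r.
have s0 := sqrtr_ge0 nu; have := sqr_sqrtr nu0.
set s := Num.sqrt nu in s0 * => s2.
have s1 : s < 1 by nra.
have : 0 < (1 - s) ^+ 2 by rewrite exprn_gt0 // subr_gt0.
by nra.
Qed.

Theorem theorem3p2 (R : realType) (n : nat) (A : 'M[R]_n) (nu : R)
    (hA : A \in unitmx)
    (hnu : nu = mxnorm2 (invmx A))
    (hnu01 : 0 < nu < 1) :
  forall omega : R,
    is_minimizer (gfun nu)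
      [set` `]0, (2 - 2 * Num.sqrt nu) / (1 - nu)[ ] omega
    <-> omega = 1.
Proof.
have [nu0 nu1] := andP hnu01.
have g1 : gfun nu 1 = 2 * nu by apply: gfun1; exact: ltW.
have g_gt y : 0 < y -> y != 1 -> 2 * nu < gfun nu y.
  move=> y0; rewrite neq_lt => /orP[y1|y1].
    by apply: gfun_gt_under => //; rewrite y0.
  exact: gfun_gt_over.
have in1 : [set` `]0, (2 - 2 * Num.sqrt nu) / (1 - nu)[ ] (1 : R).
  by rewrite /= in_itv /= ltr01 lt1_bound // ltW.
move=> omega; split=> [[]|->].
  rewrite /= in_itv /= => /andP[w0 _] /(_ 1 in1); rewrite g1 leNgt => min_w.
  by apply/eqP; apply: contraNT min_w; exact: g_gt.
split=> // y; rewrite /= in_itv /= => /andP[y0 _].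
have [->//|y1] := eqVneq y 1.
by rewrite g1 ltW // g_gt.
Qed.
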